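(* There is a deterministic algorithm that, given a non-commutative arithmetic circuit $C$ computing a polynomial $f$ in variables $x_1,\ldots,x_n$ and a non-commutative monomial $m$, outputs a non-commutative arithmetic circuit computing ${\sf pcoeff}(f,m)$, in time ${\sf poly}({\sf size}(C),n,\deg(m))$.
   Context: $R$ is an associative algebra with identity over a field $\mathbb{K}$. A non-commutative arithmetic circuit is a directed acyclic graph whose input gates are labeled by elements of $R\cup\{x_1,\ldots,x_n\}$ and whose internal gates have fan-in two and are labeled $+$ or $\times$ (a $\times$ gate computes left child times right child); it has one output gate, and ${\sf size}(C)$ is its number of gates. Write $f=\sum_{m'}c_{m'}m'$ as a sum over non-commutative monomials $m'$ (words in $x_1,\ldots,x_n$) with coefficients $c_{m'}$. Then ${\sf pcoeff}(f,m)=\sum_{m'=m\cdot m''}c_{m'}m''$, the sum over all monomials $m'$ having $m$ as a prefix, where $m''$ is the remaining suffix. *)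

(* Defs.v *)
From mathcomp Require Export all_boot all_order all_algebra.
From mathcomp Require Import finmap.
From mathcomp Require Export monalg.

Set Implicit Arguments.
Unset Strict Implicit.
Unset Printing Implicit Defensive.

Import GRing.Theory.
Local Open Scope ring_scope.

(* R<x_1, ..., x_n>: the variables commute with the coefficients, but neither
   with each other nor are the coefficients assumed to commute. *)
Notation ncmonom n := {fmonom 'I_n}.
Notation ncpoly R n := {malg R[ncmonom n]}.

Definition pcoeff (R : nzRingType) (n : nat) (f : ncpoly R n) (m : ncmonom n) :
    ncpoly R n :=
  \sum_(m' <- msupp f | prefix m m') << f@_m' *g FMonom (drop (size m) m') >>.

(* A gate of a circuit whose gates are numbered by 'I_s; the two children of a
   product gate are ordered, and the two children may coincide. *)
Inductive gate (R : Type) (n s : nat) : Type :=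
| GConst of R
| GVar of 'I_n
| GAdd of 'I_s & 'I_s
| GMul of 'I_s & 'I_s.

Arguments GConst {R n s}.
Arguments GVar {R n s}.
Arguments GAdd {R n s}.
Arguments GMul {R n s}.

Definition children (R : Type) (n s : nat) (g : gate R n s) : seq 'I_s :=
  match g with
  | GConst _ | GVar _ => [::]
  | GAdd i j | GMul i j => [:: i; j]
  end.

(* The numbering of the gates need not be a topological order. *)
Definition acyclic (s : nat) (e : rel 'I_s) : Prop :=
  forall p : seq 'I_s, cycle e p -> p = [::].

Record circuit (R : Type) (n : nat) : Type := Circuit {
  csize : nat;
  cgate : 'I_csize -> gate R n csize;
  cout : 'I_csize;
  circuit_acyclic : acyclic (fun i j => j \in children (cgate i))
}.

Section CircuitSemantics.
Variables (R : nzRingType) (n : nat) (C : circuit R n).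

Definition gate_value (v : 'I_(csize C) -> ncpoly R n)
    (g : gate R n (csize C)) : ncpoly R n :=
  match g with
  | GConst c => c%:MP
  | GVar x => << fmu x >>
  | GAdd i j => v i + v j
  | GMul i j => v i * v j
  end.

Definition valuation (v : 'I_(csize C) -> ncpoly R n) : Prop :=
  forall i, v i = gate_value v (cgate i).

Definition computes (f : ncpoly R n) : Prop :=
  exists2 v, valuation v & v (cout C) = f.

Let child : rel 'I_(csize C) := fun i j => j \in children (cgate i).

Let rank (i : 'I_(csize C)) : nat := #|connect child i|.

Let rank_child i j : child i j -> (rank j < rank i)%N.
Proof.
move=> eij; apply: proper_card; apply/properP; split.
  by apply/subsetP => k; apply: connect_trans; apply: connect1.
exists i; first exact: connect0.
apply/negP => /connectP [p ep ei].
suff /(@circuit_acyclic _ _ C) : cycle child (j :: p) by [].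
by rewrite /= rcons_path ep -ei.
Qed.

Let gate_value_ext v w (g : gate R n (csize C)) :
  (forall j, j \in children g -> v j = w j) -> gate_value v g = gate_value w g.
Proof.
case: g => [c|x|a b|a b] E; [reflexivity | reflexivity | |].
  have -> : gate_value v (GAdd a b) = v a + v b by reflexivity.
  by rewrite (E a (mem_head _ _)) (E b (mem_last a [:: b])).
have -> : gate_value v (GMul a b) = v a * v b by reflexivity.
by rewrite (E a (mem_head _ _)) (E b (mem_last a [:: b])).
Qed.

Lemma valuation_exists : exists v, valuation v.
Proof.
pose ev := fix ev k i : ncpoly R n :=
  if k is k'.+1 then gate_value (ev k') (cgate i) else 0.
have evE k l i : (rank i < k)%N -> (rank i < l)%N -> ev k i = ev l i.
  elim: k l i => [l i|k IH [i _|l i ik il]]; [by rewrite ltn0 | by rewrite ltn0 |].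
  rewrite [ev _.+1 _]/(gate_value (ev k) _) [ev l.+1 _]/(gate_value (ev l) _).
  apply: gate_value_ext => j /rank_child ji.
  by apply: IH; apply: leq_trans ji _.
exists (fun i => ev (rank i).+1 i) => i.
rewrite [LHS]/(gate_value (ev (rank i)) _).
by apply: gate_value_ext => j /rank_child ji; apply: evE.
Qed.

Lemma valuation_unique v w : valuation v -> valuation w -> v =1 w.
Proof.
move=> hv hw i; have [k] := ubnP (rank i); elim: k i => // k IH i ik.
rewrite hv hw; apply: gate_value_ext => j /rank_child ji.
by apply: IH; apply: leq_trans ji _.
Qed.

Lemma computes_exists : exists f, computes f.
Proof. by have [v hv] := valuation_exists; exists (v (cout C)); exists v. Qed.

Lemma computes_unique f g : computes f -> computes g -> f = g.
Proof. by move=> [v hv <-] [w hw <-]; apply: valuation_unique. Qed.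

End CircuitSemantics.

(* Algorithms are programs of an algebraic random access machine over R.  Its
   memory consists of arrays of natural numbers and arrays
   of elements of R; a program names the arrays it uses and computes the
   indices.  Numbers are added and subtracted (truncated) at unit cost, but
   not multiplied, so that in t steps they only reach bit length O(t) beyond
   that of the input.  The ring operations of R and the equality test of R have
   unit cost.  The only elements of R available to a program are 0, 1, the
   contents of its input, and what it computes from these.  Output is appended
   to two write-only tapes, one cell per step. *)

Inductive nexp : Type :=
| NLit of nat
| NRead of nat & nexp
| NAdd of nexp & nexp
| NSub of nexp & nexp.

Inductive rexp : Type :=
| RZero
| ROne
| RRead of nat & nexp
| RAdd of rexp & rexp
| ROpp of rexp
| RMul of rexp & rexp.

Inductive test : Type :=
| NEq of nexp & nexp
| NLt of nexp & nexp
| REq of rexp & rexp.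

Inductive program : Type :=
| NStore of nat & nexp & nexp
| RStore of nat & nexp & rexp
| NOut of nexp
| ROut of rexp
| Skip
| Seq of program & program
| If of test & program & program
| While of test & program.

Section MachineSemantics.
Variable R : nzRingType.

Record state : Type := State {
  nmem : nat -> nat -> nat;
  rmem : nat -> nat -> R;
  nout : seq nat;
  rout : seq R
}.

Definition update (T : Type) (mem : nat -> nat -> T) (a i : nat) (x : T) :
    nat -> nat -> T :=
  fun b j => if (b == a) && (j == i) then x else mem b j.

Fixpoint neval (st : state) (e : nexp) : nat :=
  match e with
  | NLit k => k
  | NRead a e1 => nmem st a (neval st e1)
  | NAdd e1 e2 => (neval st e1 + neval st e2)%N
  | NSub e1 e2 => (neval st e1 - neval st e2)%N
  end.

Fixpoint reval (st : state) (e : rexp) : R :=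
  match e with
  | RZero => 0
  | ROne => 1
  | RRead a e1 => rmem st a (neval st e1)
  | RAdd e1 e2 => reval st e1 + reval st e2
  | ROpp e1 => - reval st e1
  | RMul e1 e2 => reval st e1 * reval st e2
  end.

Definition teval (st : state) (b : test) : bool :=
  match b with
  | NEq e1 e2 => neval st e1 == neval st e2
  | NLt e1 e2 => (neval st e1 < neval st e2)%N
  | REq e1 e2 => reval st e1 == reval st e2
  end.

(* [exec p st t st']: started in st, the program p halts in st' after t steps.
   The expressions occurring in a fixed program have bounded size, so charging
   one step for the evaluation of each only affects constant factors. *)
Inductive exec : program -> state -> nat -> state -> Prop :=
| ExecNStore a e1 e2 st :
    exec (NStore a e1 e2) st 1
      (State (update (nmem st) a (neval st e1) (neval st e2))
             (rmem st) (nout st) (rout st))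
| ExecRStore a e1 e2 st :
    exec (RStore a e1 e2) st 1
      (State (nmem st) (update (rmem st) a (neval st e1) (reval st e2))
             (nout st) (rout st))
| ExecNOut e st :
    exec (NOut e) st 1
      (State (nmem st) (rmem st) (rcons (nout st) (neval st e)) (rout st))
| ExecROut e st :
    exec (ROut e) st 1
      (State (nmem st) (rmem st) (nout st) (rcons (rout st) (reval st e)))
| ExecSkip st : exec Skip st 1 st
| ExecSeq p q st st1 st2 t1 t2 :
    exec p st t1 st1 -> exec q st1 t2 st2 ->
    exec (Seq p q) st (t1 + t2) st2
| ExecIf b p q st st1 t :
    exec (if teval st b then p else q) st t st1 ->
    exec (If b p q) st t.+1 st1
| ExecWhileEnd b p st :
    ~~ teval st b -> exec (While b p) st 1 st
| ExecWhileStep b p st st1 st2 t1 t2 :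
    teval st b -> exec p st t1 st1 -> exec (While b p) st1 t2 st2 ->
    exec (While b p) st (t1 + t2).+1 st2.

Lemma exec_deterministic p st t1 st1 t2 st2 :
  exec p st t1 st1 -> exec p st t2 st2 -> t1 = t2 /\ st1 = st2.
Proof.
move=> h; elim: h t2 st2 => {p st t1 st1}.
- by move=> a e1 e2 st t2 st2 h; inversion h.
- by move=> a e1 e2 st t2 st2 h; inversion h.
- by move=> e st t2 st2 h; inversion h.
- by move=> e st t2 st2 h; inversion h.
- by move=> st t2 st2 h; inversion h.
- move=> p q st st1 st2 t1 t2 _ IH1 _ IH2 t3 st3 h.
  inversion h as [| | | | |? ? ? s1 ? u1 u2 h1 h2| | |]; subst.
  by have [? ?] := IH1 _ _ h1; subst; have [-> ->] := IH2 _ _ h2.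
- move=> b p q st st1 t _ IH t2 st2 h.
  inversion h as [| | | | | |? ? ? ? ? u h1| |]; subst.
  by have [-> ->] := IH _ _ h1.
- move=> b p st /negP hb t2 st2 h.
  by inversion h as [| | | | | | | |? ? ? ? ? ? ? hb' h1 h2].
- move=> b p st st1 st2 t1 t2 hb _ IH1 _ IH2 t3 st3 h.
  inversion h as [| | | | | | |? ? ? hb'|? ? ? s1 ? u1 u2 hb' h1 h2]; subst.
    by move: hb'; rewrite hb.
  by have [? ?] := IH1 _ _ h1; subst; have [-> ->] := IH2 _ _ h2.
Qed.

(* Array number a initially holds the a-th sequence of the input, padded with
   zeros. *)
Definition init (ns : seq (seq nat)) (rs : seq (seq R)) : state :=
  State (fun a i => nth 0%N (nth [::] ns a) i)
        (fun a i => nth 0 (nth [::] rs a) i) [::] [::].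

Definition halts_with (p : program) (ns : seq (seq nat)) (rs : seq (seq R))
    (t : nat) (ns' : seq nat) (rs' : seq R) : Prop :=
  exists st, [/\ exec p (init ns rs) t st, nout st = ns' & rout st = rs'].

End MachineSemantics.

(* A circuit with s gates is given by the number sequence consisting of s, the
   index of the output gate and three numbers per gate, together with the
   sequence of the s labels in R (0 for a gate not labelled by an element of
   R). *)

Definition gate_numbers (R : Type) (n s : nat) (g : gate R n s) : seq nat :=
  match g with
  | GConst _ => [:: 0; 0; 0]
  | GVar x => [:: 1; nat_of_ord x; 0]
  | GAdd i j => [:: 2; nat_of_ord i; nat_of_ord j]
  | GMul i j => [:: 3; nat_of_ord i; nat_of_ord j]
  end%N.

Definition gate_label (R : nzRingType) (n s : nat) (g : gate R n s) : R :=
  if g is GConst c then c else 0.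

Definition circuit_numbers (R : Type) (n : nat) (C : circuit R n) : seq nat :=
  [:: csize C, nat_of_ord (cout C) &
    flatten [seq gate_numbers (cgate i) | i <- enum 'I_(csize C)]].

Definition circuit_labels (R : nzRingType) (n : nat) (C : circuit R n) : seq R :=
  [seq gate_label (cgate i) | i <- enum 'I_(csize C)].

Definition monom_numbers (n : nat) (m : ncmonom n) : seq nat :=
  [:: n, size m & [seq nat_of_ord x | x <- m]].

Definition maps_circuit (p : program) (R : nzRingType) (n : nat)
    (C : circuit R n) (m : ncmonom n) (t : nat) (C' : circuit R n) : Prop :=
  halts_with p [:: circuit_numbers C; monom_numbers m] [:: circuit_labels C]
    t (circuit_numbers C') (circuit_labels C').

(* Main.v *)
Require Import Defs.
From HB Require Import structures.
From mathcomp Require Import zify.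

(* Let d be the degree of m, and let each variable x act on the states 0, ..., d
   of an automaton reading m: it moves a to a + 1 if x is the letter of m at
   position a, and it loops on the state d with weight x.  The resulting
   (d + 1) x (d + 1) matrices over R<x_1, ..., x_n> commute with the constants,
   so they define a ring morphism, and the entry (0, d) of the image of f is
   pcoeff(f, m).  Evaluating C at these matrices entry by entry multiplies its
   size by a polynomial in d.  As the gates of a circuit may be numbered in any
   order, the gates can be written down in one loop over their indices, without
   sorting C topologically and without any arithmetic in R. *)

Set Implicit Arguments.
Unset Strict Implicit.
Unset Printing Implicit Defensive.

Import GRing.Theory.

(** * Transition matrices of the prefix automaton *)

Section PrefixAutomaton.
Local Open Scope ring_scope.
Variables (R : nzRingType) (n : nat) (m : ncmonom n).
Local Notation d := (size m).
Local Notation letter_at a := (nth 0%N [seq nat_of_ord x | x <- m] a).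

(** For indices of the matrix, the default of [nth] does no harm: it can be met only at [a = d],
    where [b = a.+1] lies outside the matrix. *)
Definition letter_entry (x : 'I_n) (a b : nat) : ncpoly R n :=
  if (a == b) && (a == d) then << fmu x >>
  else ((b == a.+1) && (letter_at a == x))%:R.

Definition letter_mx (x : 'I_n) : 'M[ncpoly R n]_d.+1 :=
  \matrix_(a, b) letter_entry x a b.

Definition word_mx (w : ncmonom n) : 'M[ncpoly R n]_d.+1 :=
  \prod_(x <- w) letter_mx x.

Lemma word_mx_mmorphism : mmorphism word_mx.
Proof.
split=> [u v|]; last by rewrite /word_mx fm1 big_nil.
by rewrite /word_mx fmM big_cat.
Qed.

HB.instance Definition _ :=
  isMultiplicative.Build _ 'M[ncpoly R n]_d.+1 word_mx word_mx_mmorphism.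

Definition const_scalar (c : R) : 'M[ncpoly R n]_d.+1 := (c%:MP)%:M.

Lemma const_scalar_additive : zmod_morphism const_scalar.
Proof. by move=> b c; rewrite /const_scalar !raddfB. Qed.

HB.instance Definition _ :=
  GRing.isZmodMorphism.Build R 'M[ncpoly R n]_d.+1 const_scalar
    const_scalar_additive.

Lemma const_scalar_multiplicative : monoid_morphism const_scalar.
Proof.
split=> [|b c]; first by rewrite /const_scalar mpolyC1E.
by rewrite /const_scalar mpolyCM scalar_mxM.
Qed.

HB.instance Definition _ :=
  GRing.isMonoidMorphism.Build R 'M[ncpoly R n]_d.+1 const_scalar
    const_scalar_multiplicative.

Definition automaton_mx (f : ncpoly R n) : 'M[ncpoly R n]_d.+1 :=
  mmap const_scalar word_mx f.

Lemma malgC_comm_monomial (c : R) (w : ncmonom n) :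
  GRing.comm c%:MP (<< w >> : ncpoly R n).
Proof.
by rewrite /GRing.comm !malgM_def fgmulUU fgmulUU mul1m mulm1 mul1r mulr1.
Qed.

(** As [R] need not be commutative, [mmap] is multiplicative only under such a condition. It holds
    because the entries of a letter matrix are monomials, 0 or 1, all of which commute with the
    constants. *)
Lemma const_scalar_comm (c : R) (w : ncmonom n) :
  GRing.comm (const_scalar c) (word_mx w).
Proof.
apply: commr_prod => x _; apply/matrixP => a b.
rewrite -[_ * _ in LHS]/(_ *m _) -[_ * _ in RHS]/(_ *m _) mul_scalar_mx.
rewrite !mxE (bigD1 b) //= big1 => [|e /negPf eb].
  rewrite !mxE eqxx mulr1n addr0 /letter_entry; case: ifP => _.
    exact: malgC_comm_monomial.
  exact: commr_nat.
by rewrite !mxE eb mulr0n mulr0.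
Qed.

Lemma automaton_mxD : {morph automaton_mx : f g / f + g}.
Proof. exact: mmapD. Qed.

Lemma automaton_mxM : {morph automaton_mx : f g / f * g}.
Proof.
apply: (commr_mmap_is_multiplicative _).1 => g u v; exact: const_scalar_comm.
Qed.

Lemma automaton_mxC (c : R) : automaton_mx c%:MP = (c%:MP)%:M.
Proof. exact: mmapC. Qed.

Lemma automaton_mxX (x : 'I_n) : automaton_mx << fmu x >> = letter_mx x.
Proof.
by rewrite /automaton_mx mmapU /= rmorph1 mul1r /word_mx fmU big_seq1.
Qed.

(** Induction on [w] with the state [a] kept general: from [a] the automaton must first read the
    rest [drop a m] of the monomial, and every later letter contributes its weight on the loop at
    [d]. *)
Lemma word_mx_last (w : ncmonom n) (a : 'I_d.+1) :
  word_mx w a ord_max =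
  if prefix (drop a m) w then << FMonom (drop (d - a) w) >> else 0.
Proof.
case: w => w; rewrite /word_mx /=.
elim: w a => [|x w IH] a.
  rewrite big_nil mxE prefixs0 -size_eq0 size_drop subn_eq0 -val_eqE /=.
  by rewrite eqn_leq -ltnS ltn_ord /=; case: leqP => // _; rewrite -fmoneE.
rewrite big_cons -[_ * _ in LHS]/(_ *m _) mxE.
set P := \prod_(j <- w) _ in IH *.
(* Row [a] of the first letter matrix has at most one nonzero entry: the loop in the state [d], the
   move to [a.+1] in an earlier state. *)
have [da|ad] := leqP d a.
  have -> : a = ord_max.
    by apply/eqP; rewrite -val_eqE eqn_leq -ltnS ltn_ord.
  rewrite (bigD1 ord_max) //= big1 => [|e /negPf ed]; last first.
    rewrite mxE /letter_entry eq_sym -[e == _ :> nat]/(e == ord_max) ed /=.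
    by rewrite ltn_eqF ?mul0r // ltn_ord.
  rewrite mxE /letter_entry !eqxx addr0 IH drop_size subnn !drop0 !prefix0s.
  by rewrite malgM_def fgmulUU mul1r -[mmul _ _]/(fmmul _ _) fmmulE fmuE.
pose a' : 'I_d.+1 := Ordinal (ad : (a.+1 < d.+1)%N).
rewrite (bigD1 a') //= big1 => [|e /negPf ea]; last first.
  rewrite mxE /letter_entry (ltn_eqF ad) andbF.
  by rewrite -[e == a.+1 :> nat]/(e == a') ea mul0r.
rewrite mxE /letter_entry (ltn_eqF ad) andbF eqxx addr0 IH.
rewrite -[nat_of_ord a']/a.+1 (drop_nth x ad) -(subnSK ad) [drop _ (x :: w)]/=.
rewrite (nth_map x) // val_eqE /=.
by case: eqP => _; rewrite ?mul1r ?mul0r.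
Qed.

Lemma automaton_mx_pcoeff (f : ncpoly R n) :
  automaton_mx f ord0 ord_max = pcoeff f m.
Proof.
rewrite /automaton_mx mmapE summxE /pcoeff [RHS]big_mkcond /=.
apply: eq_bigr => w _; rewrite -[_ * _ in LHS]/(_ *m _) mul_scalar_mx mxE.
rewrite word_mx_last drop0 subn0; case: ifP => _; last by rewrite mulr0.
by rewrite malgM_def fgmulUU mul1m mulr1.
Qed.

End PrefixAutomaton.

(** * The circuit of matrix entries *)

Section Ranking.
Variables (s : nat) (e : rel 'I_s).

(** The rank counts reachable vertices: a child reaches only what its parent reaches, and acyclicity
    keeps it from reaching the parent itself. *)
Lemma acyclic_rank :
  acyclic e -> exists r : 'I_s -> nat, forall i j, e i j -> (r j < r i)%N.
Proof.
move=> ac; exists (fun i => #|connect e i|) => i j eij.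
apply: proper_card; apply/properP; split.
  by apply/subsetP => k; apply: connect_trans; apply: connect1.
exists i; first exact: connect0.
apply/negP => /connectP [p ep ei].
suff /ac : cycle e (j :: p) by [].
by rewrite /= rcons_path ep -ei.
Qed.

(** Ranks decrease along paths, so the first vertex of a nonempty cycle would have a rank smaller
    than itself. *)
Lemma rank_acyclic (r : 'I_s -> nat) :
  (forall i j, e i j -> (r j < r i)%N) -> acyclic e.
Proof.
move=> re [//|x p] /= /(sub_path re) ep.
have tr : transitive (fun i j => (r j < r i)%N).
  by move=> y z t h1 h2; apply: ltn_trans h2 h1.
have /allP /(_ x) := order_path_min tr ep.
by rewrite mem_rcons mem_head ltnn => /(_ isT).
Qed.

End Ranking.

Section Cells.
Variable D : nat.

(** Positional notation in base [D]: for [a], [b], [e] below [D], repeated division with remainder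
    recovers the coordinates. *)
Definition cell (i a b e : nat) : nat := (((i * D + a) * D + b) * D + e)%N.

Lemma cellP (s z : nat) :
  (z < s * D * D * D)%N ->
  exists i : 'I_s, exists a b e : 'I_D, z = cell i a b e.
Proof.
move=> zs; have D0 : (0 < D)%N by case: (D) zs => //; rewrite !muln0.
have is' : (z %/ D %/ D %/ D < s)%N by rewrite !ltn_divLR.
have lt x : (x %% D < D)%N by rewrite ltn_mod.
exists (Ordinal is'), (Ordinal (lt (z %/ D %/ D)%N)), (Ordinal (lt (z %/ D)%N)).
by exists (Ordinal (lt z)); rewrite /cell /= -!divn_eq.
Qed.

Lemma digit_lt (x y t : nat) :
  (x < y)%N -> (t < D)%N -> (x * D + t < y * D)%N.
Proof.
move=> xy tD; apply: (@leq_trans (x.+1 * D)); last by rewrite leq_mul2r xy orbT.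
by rewrite mulSn addnC ltn_add2r.
Qed.

Lemma cell_lt (s i a b e : nat) :
  (i < s)%N -> (a < D)%N -> (b < D)%N -> (e < D)%N ->
  (cell i a b e < s * D * D * D)%N.
Proof. by move=> ? ? ? ?; rewrite /cell !digit_lt. Qed.

Lemma cell_coords (i a b e : nat) (z := cell i a b e) :
  (a < D)%N -> (b < D)%N -> (e < D)%N ->
  [/\ z %% D = e, z %/ D %% D = b, z %/ D %/ D %% D = a
    & z %/ D %/ D %/ D = i]%N.
Proof.
have div x t : (t < D)%N -> ((x * D + t) %/ D = x)%N.
  by move=> tD; rewrite divnMDl ?divn_small ?addn0 //; apply: leq_trans tD.
have mod x t : (t < D)%N -> ((x * D + t) %% D = t)%N.
  by move=> tD; rewrite modnMDl modn_small.
by move=> aD bD eD; rewrite /z /cell; split; rewrite ?div // mod.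
Qed.

End Cells.

Section QuotientCircuit.
Local Open Scope ring_scope.
Variables (R : nzRingType) (n : nat) (C : circuit R n) (m : ncmonom n).
Local Notation s := (csize C).
Local Notation d := (size m).
Local Notation D := (size m).+1.
Local Notation letter_at a := (nth 0%N [seq nat_of_ord x | x <- m] a).

(* The cell (i, a, b, e) carries two gates.  If the gate i of C is a product of
   the gates j and k, the even one computes the product of the entry (a, e) of
   j and the entry (e, b) of k, and the odd one the partial sum of these
   products up to e; otherwise both compute the entry (a, b) of i.  In all cases
   the entry (a, b) of i is found at the odd gate of (i, a, b, d). *)
Definition cells : nat := (s * D * D * D)%N.
Local Notation N := cells.*2.

Definition entry_index (j a b : nat) : nat := (cell D j a b d).*2.+1.

(* All indices passed to [insubd] are in range, so its default is not used. *)
Definition row_gate (i a b e : nat) (y : 'I_N) : gate R n N :=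
  let mk := insubd y in
  match cgate (insubd (cout C) i) with
  | GConst c => GConst (if a == b then c else 0)
  | GVar x =>
      if (a == b) && (a == d) then GVar x
      else GConst (if (b == a.+1) && (letter_at a == x) then 1 else 0)
  | GAdd j k => GAdd (mk (entry_index j a b)) (mk (entry_index k a b))
  | GMul j k =>
      if odd y && (0 < e)%N then GAdd (mk y.-1) (mk y.-2)
      else GMul (mk (entry_index j a e)) (mk (entry_index k e b))
  end.

Definition quotient_gate (y : 'I_N) : gate R n N :=
  let z := y./2 in
  row_gate (z %/ D %/ D %/ D) (z %/ D %/ D %% D) (z %/ D %% D) (z %% D) y.

Lemma quotient_gateE (y : 'I_N) (i : 'I_s) (a b e : 'I_D) :
  y./2 = cell D i a b e -> quotient_gate y = row_gate i a b e y.
Proof.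
rewrite /quotient_gate => ->.
by have [-> -> -> ->] := cell_coords i (ltn_ord a) (ltn_ord b) (ltn_ord e).
Qed.

Lemma gate_coordsP (y : 'I_N) :
  exists i : 'I_s, exists a b e : 'I_D, y./2 = cell D i a b e.
Proof. by apply: cellP; rewrite ltn_half_double. Qed.

Lemma entry_index_lt (j : 'I_s) (a b : 'I_D) : (entry_index j a b < N)%N.
Proof. by rewrite /entry_index ltn_Sdouble cell_lt. Qed.

Lemma val_entry (y : 'I_N) (j : 'I_s) (a b : 'I_D) :
  nat_of_ord (insubd y (entry_index j a b)) = entry_index j a b.
Proof. by have := val_insubd y (entry_index j a b); rewrite entry_index_lt. Qed.

Lemma half_entry (y : 'I_N) (j : 'I_s) (a b : 'I_D) :
  (nat_of_ord (insubd y (entry_index j a b)))./2 =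
  cell D j a b (ord_max : 'I_D).
Proof. by rewrite val_entry -[_./2]/(uphalf _.*2) uphalf_double. Qed.

Lemma val_below (y : 'I_N) (k : nat) :
  (k <= y)%N -> nat_of_ord (insubd y k) = k.
Proof.
by move=> ky; have := val_insubd y k; rewrite (leq_ltn_trans ky) // ltn_ord.
Qed.

Lemma cell_pred (i a b e : nat) :
  (0 < e)%N -> (cell D i a b e).-1 = cell D i a b e.-1.
Proof. by case: e => // e _; rewrite /cell addnS. Qed.

Section Rank.
Variable r : 'I_s -> nat.

(** The lexicographic order by the rank in [C], then [e], then parity, packed into one number. The
    second summand stays below [D.*2], so passing to an entry of a child gate always lowers the
    rank, while partial sums descend within one block. *)
Definition quotient_rank (y : 'I_N) : nat :=
  let z := y./2 in
  (r (insubd (cout C) (z %/ D %/ D %/ D)) * D.*2 + ((z %% D).*2 + odd y))%N.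

Lemma quotient_rankE (y : 'I_N) (i : 'I_s) (a b e : 'I_D) :
  y./2 = cell D i a b e -> quotient_rank y = (r i * D.*2 + (e.*2 + odd y))%N.
Proof.
rewrite /quotient_rank => ->.
have [-> _ _ ->] := cell_coords i (ltn_ord a) (ltn_ord b) (ltn_ord e).
by rewrite valKd.
Qed.

Hypothesis rank_child : forall i j, j \in children (cgate i) -> (r j < r i)%N.

Lemma quotient_rank_child (y y' : 'I_N) :
  y' \in children (quotient_gate y) -> (quotient_rank y' < quotient_rank y)%N.
Proof.
have [i [a [b [e yE]]]] := gate_coordsP y.
have entry (j : 'I_s) (a' b' : 'I_D) : (r j < r i)%N ->
    (quotient_rank (insubd y (entry_index j a' b')) < quotient_rank y)%N.
  move=> ji; rewrite (quotient_rankE yE) (quotient_rankE (half_entry _ _ _ _)).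
  rewrite val_entry /= odd_double addn1.
  apply: (@leq_trans ((r j).+1 * D.*2)); last first.
    by rewrite (leq_trans _ (leq_addr _ _)) // leq_mul2r ji orbT.
  by rewrite mulSn addnC ltn_add2r ltnS.
rewrite (quotient_gateE yE) /row_gate valKd.
case gi: (cgate i) => [c|x|j k|j k] //; first by case: ifP.
  have rj : (r j < r i)%N by apply: rank_child; rewrite gi mem_head.
  have rk : (r k < r i)%N by apply: rank_child; rewrite gi (mem_last j [:: k]).
  by rewrite !inE => /orP [] /eqP ->; apply: entry.
have rj : (r j < r i)%N by apply: rank_child; rewrite gi mem_head.
have rk : (r k < r i)%N by apply: rank_child; rewrite gi (mem_last j [:: k]).
case: ifP => [/andP [oy e0]|_]; last first.
  by rewrite !inE => /orP [] /eqP ->; apply: entry.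
(* A partial sum refers to the even gate of its own cell and to the odd gate of the cell with [e]
   lowered by one. *)
have y1 : nat_of_ord y = (cell D i a b e).*2.+1.
  by rewrite -(odd_double_half y) oy yE.
have y2 : (y.-1 <= y)%N by rewrite leq_pred.
have y3 : (y.-2 <= y)%N by rewrite (leq_trans (leq_pred _)).
rewrite (quotient_rankE yE) oy !inE => /orP [] /eqP ->.
  have yE' : (nat_of_ord (insubd y y.-1))./2 = cell D i a b e.
    by rewrite val_below // y1 /= doubleK.
  rewrite (quotient_rankE yE') val_below // y1 /= odd_double ltn_add2l.
  by rewrite addn0 addn1.
have e1 : (e.-1 < D)%N by rewrite (leq_ltn_trans (leq_pred _)).
have yE' : (nat_of_ord (insubd y y.-2))./2 = cell D i a b (Ordinal e1).
  rewrite val_below // y1 /= -cell_pred //; case: (cell _ _ _ _ _) => //= z.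
  by rewrite uphalf_double.
rewrite (quotient_rankE yE') ltn_add2l addn1 ltnS /=.
rewrite -[X in (_ <= X.*2)%N](prednK e0).
(* The inequality holds for either parity of [y.-2], which is therefore not computed. *)
by rewrite doubleS; case: (odd _); rewrite ?addn1 ?addn0 ltnW.
Qed.

Lemma quotient_acyclic : acyclic (fun i j => j \in children (quotient_gate i)).
Proof. exact: rank_acyclic quotient_rank_child. Qed.

End Rank.

Lemma quotient_circuit_acyclic : 
  acyclic (fun i j => j \in children (quotient_gate i)).
Proof.
have [r rP] := acyclic_rank (@circuit_acyclic _ _ C).
exact: (@quotient_acyclic r).
Qed.

Definition quotient_circuit : circuit R n :=
  @Circuit R n N quotient_gate
    (Ordinal (entry_index_lt (cout C) ord0 ord_max)) quotient_circuit_acyclic.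

Section Value.
Variable v : 'I_s -> ncpoly R n.
Hypothesis v_valuation : valuation v.
Local Notation A j := (automaton_mx m (v j)).

(** Since [computes] asks for a valuation, the intended values are written down in closed form and
    checked gate by gate, without induction along the circuit. *)
Definition quotient_value (y : 'I_N) : ncpoly R n :=
  let z := y./2 in
  let a : 'I_D := inord (z %/ D %/ D %% D) in
  let b : 'I_D := inord (z %/ D %% D) in
  let e : 'I_D := inord (z %% D) in
  let i := insubd (cout C) (z %/ D %/ D %/ D)%N in
  match cgate i with
  | GMul j k =>
      if odd y then \sum_(e' < D | (e' <= e)%N) A j a e' * A k e' b
      else A j a e * A k e b
  | _ => A i a b
  end.

Lemma quotient_valueE (y : 'I_N) (i : 'I_s) (a b e : 'I_D) :
  y./2 = cell D i a b e ->
  quotient_value y =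
  match cgate i with
  | GMul j k =>
      if odd y then \sum_(e' < D | (e' <= e)%N) A j a e' * A k e' b
      else A j a e * A k e b
  | _ => A i a b
  end.
Proof.
rewrite /quotient_value => ->.
have [-> -> -> ->] := cell_coords i (ltn_ord a) (ltn_ord b) (ltn_ord e).
by rewrite !inord_val valKd.
Qed.

(** For a product, the index chosen has [e = d], where the partial sum is complete and equals the
    entry of the matrix product. *)
Lemma quotient_value_entry (y : 'I_N) (j : 'I_s) (a b : 'I_D) :
  quotient_value (insubd y (entry_index j a b)) = A j a b.
Proof.
rewrite (quotient_valueE (half_entry _ _ _ _)) val_entry /= odd_double /=.
case gj: (cgate j) => [c|x|k l|k l] //.
rewrite [in RHS]v_valuation gj /= automaton_mxM.
rewrite -[_ * _ in RHS]/(_ *m _) mxE.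
by apply: eq_bigl => e'; rewrite -ltnS ltn_ord.
Qed.

Lemma quotient_valuation :
  @valuation R n quotient_circuit quotient_value.
Proof.
move=> y; change 'I_N in y.
rewrite -[RHS]/(@gate_value _ _ quotient_circuit quotient_value
  (quotient_gate y)).
have [i [a [b [e yE]]]] := gate_coordsP y.
rewrite (quotient_gateE yE) (quotient_valueE yE) /row_gate valKd.
case gi: (cgate i) => [c|x|j k|j k] /=.
- rewrite v_valuation gi /= automaton_mxC mxE.
  by rewrite -val_eqE /=; case: (_ == _ :> nat); rewrite ?raddf0.
- rewrite v_valuation gi /= automaton_mxX mxE /letter_entry.
  case: ifP => // _ /=; case: ifP => _ /=; first by rewrite mpolyC1E.
  by rewrite malgC0E.
- by rewrite v_valuation gi /= automaton_mxD mxE !quotient_value_entry.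
case oy: (odd y) => /=; last by rewrite !quotient_value_entry.
have y1 : nat_of_ord y = (cell D i a b e).*2.+1.
  by rewrite -(odd_double_half y) oy yE.
(* At [e = 0] the partial sum has a single term, and the odd gate is itself a product. *)
case: (posnP e) => [e0|e0] /=.
  rewrite (bigD1 e) //= big1 ?addr0 ?quotient_value_entry // => e' /andP [].
  by rewrite e0 leqn0 -val_eqE /= e0 => ->.
have y2 : (y.-1 <= y)%N by rewrite leq_pred.
have y3 : (y.-2 <= y)%N by rewrite (leq_trans (leq_pred _)).
have y2E : (nat_of_ord (insubd y y.-1))./2 = cell D i a b e.
  by rewrite val_below // y1 /= doubleK.
have e1 : (e.-1 < D)%N by rewrite (leq_ltn_trans (leq_pred _)).
have y3E : (nat_of_ord (insubd y y.-2))./2 = cell D i a b (Ordinal e1).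
  rewrite val_below // y1 /= -cell_pred //; case: (cell _ _ _ _ _) => //= z.
  by rewrite uphalf_double.
rewrite (quotient_valueE y2E) (quotient_valueE y3E) gi !val_below // y1 /=.
rewrite odd_double.
(* This would fail for the cell 0, where the truncated predecessor is 0; [0 < e] excludes that
   cell. *)
have -> : odd (cell D i a b e).*2.-1.
  have : (0 < cell D i a b e)%N by rewrite /cell addn_gt0 e0 orbT.
  by case: (cell _ _ _ _ _) => //= z _; rewrite odd_double.
rewrite (bigD1 e) //=; congr (_ + _); apply: eq_bigl => e'.
by rewrite /= -[RHS]ltnS prednK // ltn_neqAle andbC.
Qed.

End Value.

Lemma quotient_circuit_computes (f : ncpoly R n) :
  computes C f -> computes quotient_circuit (pcoeff f m).
Proof.
case=> v v_val <-; exists (quotient_value v); first exact: quotient_valuation.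
rewrite -automaton_mx_pcoeff.
set y : 'I_N := cout quotient_circuit.
rewrite -(quotient_value_entry v_val y); congr quotient_value.
by apply/val_inj; exact: esym (val_entry _ _ _ _).
Qed.

End QuotientCircuit.

(** * Loop-free programs and loops *)

Section StraightLine.
Local Open Scope ring_scope.
Variable R : nzRingType.
Implicit Types (p q : program) (st : state R).

Fixpoint loop_free p : bool :=
  match p with
  | Seq p q | If _ p q => loop_free p && loop_free q
  | While _ _ => false
  | _ => true
  end.

(** The values of [cost] and [run] at [While] are placeholders: both describe executions of
    loop-free programs only. *)
Fixpoint cost p : nat :=
  match p with
  | Seq p q => cost p + cost q
  | If _ p q => (maxn (cost p) (cost q)).+1
  | While _ _ => 0
  | _ => 1
  end%N.

Fixpoint run p st : state R :=
  match p with
  | NStore a e1 e2 =>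
      State (update (nmem st) a (neval st e1) (neval st e2))
            (rmem st) (nout st) (rout st)
  | RStore a e1 e2 =>
      State (nmem st) (update (rmem st) a (neval st e1) (reval st e2))
            (nout st) (rout st)
  | NOut e => State (nmem st) (rmem st) (rcons (nout st) (neval st e)) (rout st)
  | ROut e => State (nmem st) (rmem st) (nout st) (rcons (rout st) (reval st e))
  | Seq p q => run q (run p st)
  | If b p q => if teval st b then run p st else run q st
  | Skip | While _ _ => st
  end.

Lemma exec_run p st :
  loop_free p -> exists2 t, exec p st t (run p st) & (t <= cost p)%N.
Proof.
elim: p st => [a e1 e2|a e1 e2|e|e||p IHp q IHq|b p IHp q IHq|//] st /=;
  try by move=> _; exists 1%N => //; constructor.
- move=> /andP [/IHp {}IHp /IHq {}IHq].
  have [t1 h1 c1] := IHp st; have [t2 h2 c2] := IHq (run p st).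
  by exists (t1 + t2)%N; [apply: ExecSeq h1 h2 | apply: leq_add].
move=> /andP [/IHp {}IHp /IHq {}IHq].
have [t h c] : exists2 t, exec (if teval st b then p else q) st t
    (if teval st b then run p st else run q st) &
    (t <= maxn (cost p) (cost q))%N.
  case: ifP => _; [have [t h c] := IHp st | have [t h c] := IHq st];
  by exists t => //; rewrite leq_max c ?orbT.
by exists t.+1 => //; apply: ExecIf.
Qed.

(** The invariant is indexed by the number of completed rounds. Each of the [N] rounds costs one
    test and the body, and a last failing test ends the loop. *)
Lemma exec_while b p (I : nat -> state R -> Prop) (N : nat) st :
  loop_free p ->
  (forall k st, I k st -> (k <= N)%N -> teval st b = (k < N)%N) ->
  (forall k st, I k st -> (k < N)%N -> I k.+1 (run p st)) ->
  I 0%N st ->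
  exists t st', [/\ exec (While b p) st t st', I N st' &
    (t <= N * (cost p).+1 + 1)%N].
Proof.
move=> lf guard step.
(* Here [k] is the number of rounds still to come, on which the induction runs. *)
suff loop k st0 : (k <= N)%N -> I (N - k)%N st0 ->
    exists t st', [/\ exec (While b p) st0 t st', I N st' &
      (t <= k * (cost p).+1 + 1)%N].
  by move=> I0; apply: loop; rewrite // subnn.
elim: k st0 => [|k IH] st0 kN Ik.
  exists 1%N, st0; split=> //; last by rewrite subn0 in Ik.
  by apply: ExecWhileEnd; rewrite (guard _ _ Ik) ?leq_subr // subn0 ltnn.
have lt : (N - k.+1 < N)%N by rewrite ltn_subrL (leq_trans _ kN).
have := step _ _ Ik lt; rewrite subnSK // => /(IH _ (ltnW kN)).
move=> [t2 [st2 [h2 I2 c2]]]; have [t1 h1 c1] := exec_run st0 lf.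
exists (t1 + t2).+1, st2; split=> //.
  by apply: ExecWhileStep h1 h2; rewrite (guard _ _ Ik) // leq_subr.
by rewrite mulSn -addnA addSn ltnS leq_add.
Qed.

Definition append st (ns : seq nat) (rs : seq R) : state R :=
  State (nmem st) (rmem st) (nout st ++ ns) (rout st ++ rs).

Lemma append_cat st ns rs ns' rs' :
  append (append st ns rs) ns' rs' = append st (ns ++ ns') (rs ++ rs').
Proof. by rewrite /append /= !catA. Qed.

Lemma neval_output st ns rs e :
  neval (State (nmem st) (rmem st) ns rs) e = neval st e.
Proof. by elim: e => //= [a e ->|e -> f ->|e -> f ->]. Qed.

Lemma reval_output st ns rs e :
  reval (State (nmem st) (rmem st) ns rs) e = reval st e.
Proof.
by elim: e => //= [a e|e -> f ->|e ->|e -> f ->]; rewrite ?neval_output.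
Qed.

Lemma neval_append st ns rs e : neval (append st ns rs) e = neval st e.
Proof. exact: neval_output. Qed.

Lemma reval_append st ns rs e : reval (append st ns rs) e = reval st e.
Proof. exact: reval_output. Qed.

Definition emit (e0 e1 e2 : nexp) (r : rexp) : program :=
  Seq (NOut e0) (Seq (NOut e1) (Seq (NOut e2) (ROut r))).

Lemma run_emit e0 e1 e2 r st :
  run (emit e0 e1 e2 r) st =
  append st [:: neval st e0; neval st e1; neval st e2] [:: reval st r].
Proof.
by rewrite /= !neval_output reval_output /append -!cats1 -!catA.
Qed.

End StraightLine.

(** * The program *)

Section Program.
Local Open Scope nat_scope.

Local Notation "x +e y" := (NAdd x y) (at level 50, left associativity).
Local Coercion NLit : nat >-> nexp.

(* Arrays 0 and 1 hold the input, and the entry x of array 2 will be x * D with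
   D = d + 1, which replaces the missing multiplication.  The first entries of
   the arrays 3 to 8 are variables: the length of the table, and the index and
   the coordinates e, b, a, i of the current cell. *)
Definition var (k : nat) : nexp := NRead k 0.
Definition size_exp : nexp := NRead 0 0.
Definition degree_exp : nexp := NRead 1 1.
Definition times_dim (e : nexp) : nexp := NRead 2 e.
Definition double_exp (e : nexp) : nexp := e +e e.
Definition cell_exp (i a b e : nexp) : nexp :=
  times_dim (times_dim (times_dim i +e a) +e b) +e e.
Definition entry_exp (j a b : nexp) : nexp :=
  double_exp (cell_exp j a b degree_exp) +e 1.

Definition z_exp : nexp := var 4.
Definition e_exp : nexp := var 5.
Definition b_exp : nexp := var 6.
Definition a_exp : nexp := var 7.
Definition i_exp : nexp := var 8.

(** The block of gate [i] starts at [2 + 3 * i], after the two header numbers; [3 * i] is formed by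
    addition. *)
Definition field (k : nat) : nexp :=
  NRead 0 (NLit k.+2 +e (i_exp +e (i_exp +e i_exp))).

(* The guard reads the table that is being filled: only when the table reaches
   s do the terms s * D, and later s * D * D, acquire their final values. *)
Definition fill_guard : test :=
  NLt (var 3)
    (size_exp +e (times_dim size_exp +e times_dim (times_dim size_exp))).

Definition fill_body : program :=
  Seq (NStore 2 (var 3 +e 1) (times_dim (var 3) +e (degree_exp +e 1)))
      (NStore 3 0 (var 3 +e 1)).

Definition cells_exp : nexp := times_dim (times_dim (times_dim size_exp)).

Definition emit_header : program :=
  Seq (NOut (double_exp cells_exp)) (NOut (entry_exp (NRead 0 1) 0 degree_exp)).

(** The two gates of a cell coincide, except for a product with [0 < e]. *)
Definition twice (p : program) : program := Seq p p.
Definition emit_const (r : rexp) : program := twice (emit 0 0 0 r).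

Definition emit_const_gate : program :=
  If (NEq a_exp b_exp) (emit_const (RRead 0 i_exp)) (emit_const RZero).

Definition emit_var_gate : program :=
  If (NEq a_exp b_exp)
    (If (NEq a_exp degree_exp) (twice (emit 1 (field 1) 0 RZero))
      (emit_const RZero))
    (If (NEq b_exp (a_exp +e 1))
      (If (NEq (NRead 1 (NLit 2 +e a_exp)) (field 1)) (emit_const ROne)
        (emit_const RZero))
      (emit_const RZero)).

Definition emit_add_gate : program :=
  twice (emit 2 (entry_exp (field 1) a_exp b_exp)
                (entry_exp (field 2) a_exp b_exp) RZero).

(** The partial sum is gate [2z + 1], so its operands, the product of the same cell and the
    preceding partial sum, are the gates [2z] and [2z - 1]. *)
Definition emit_mul_gate : program :=
  let product := emit 3 (entry_exp (field 1) a_exp e_exp)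
                        (entry_exp (field 2) e_exp b_exp) RZero in
  Seq product
    (If (NLt 0 e_exp)
      (emit 2 (double_exp z_exp) (NSub (double_exp z_exp) 1) RZero)
      product).

Definition emit_gates : program :=
  If (NEq (field 0) 0) emit_const_gate
    (If (NEq (field 0) 1) emit_var_gate
      (If (NEq (field 0) 2) emit_add_gate emit_mul_gate)).

Definition carry (k : nat) (p : program) : program :=
  Seq (NStore k 0 (var k +e 1))
    (If (NEq (var k) (degree_exp +e 1)) (Seq (NStore k 0 0) p) Skip).

(** An odometer in base [D]: keeping the digits of [z] alongside [z] avoids division on the machine.
    The leading digit [i] never wraps around. *)
Definition advance : program :=
  Seq (NStore 4 0 (z_exp +e 1))
    (carry 5 (carry 6 (carry 7 (NStore 8 0 (i_exp +e 1))))).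

Definition main_guard : test := NLt z_exp cells_exp.
Definition main_body : program := Seq emit_gates advance.

Definition quotient_program : program :=
  Seq (While fill_guard fill_body)
    (Seq emit_header (While main_guard main_body)).

End Program.

(** * Correctness and running time of the program *)

Section Correctness.
Local Open Scope ring_scope.
Variables (R : nzRingType) (n : nat) (C : circuit R n) (m : ncmonom n).
Local Notation s := (csize C).
Local Notation d := (size m).
Local Notation D := (size m).+1.
Local Notation N := (cells C m).*2.
Implicit Type st : state R.

Definition has_input st : Prop :=
  [/\ forall j, nmem st 0 j = nth 0%N (circuit_numbers C) j,
      forall j, nmem st 1 j = nth 0%N (monom_numbers m) j &
      forall j, rmem st 0 j = nth 0 (circuit_labels C) j].

(** Extending the gates to all natural numbers lets the output written so far be described over an
    initial segment [iota 0 k]. *)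
Definition gate_numbers_at (y : nat) : seq nat :=
  if insub y : option 'I_N is Some y' then gate_numbers (quotient_gate y')
  else [::].

Definition gate_label_at (y : nat) : R :=
  if insub y : option 'I_N is Some y' then gate_label (quotient_gate y') else 0.

Definition numbers_upto (k : nat) : seq nat :=
  [:: N, entry_index m (cout C) 0 d &
    flatten [seq gate_numbers_at y | y <- iota 0 k]].

Definition labels_upto (k : nat) : seq R :=
  [seq gate_label_at y | y <- iota 0 k].

Lemma numbers_upto_all :
  numbers_upto N = circuit_numbers (quotient_circuit C m).
Proof.
rewrite /circuit_numbers /numbers_upto; congr [:: _, _ & flatten _].
rewrite -val_enum_ord -map_comp.
by apply: eq_map => y /=; rewrite /gate_numbers_at valK.
Qed.

Lemma labels_upto_all : labels_upto N = circuit_labels (quotient_circuit C m).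
Proof.
rewrite /circuit_labels /labels_upto -val_enum_ord -map_comp.
by apply: eq_map => y /=; rewrite /gate_label_at valK.
Qed.

Lemma nth_flatten_uniform (T : Type) (x0 : T) (w : nat) (rows : seq (seq T))
    (i k : nat) :
  all (fun r => size r == w) rows -> (k < w)%N ->
  nth x0 (flatten rows) (i * w + k) = nth x0 (nth [::] rows i) k.
Proof.
move=> + kw; elim: rows i => [|r rows IH] i /=; first by rewrite !nth_nil.
case/andP => /eqP rw /IH {}IH; rewrite nth_cat rw; case: i => [|i] /=.
  by rewrite mul0n add0n kw.
by rewrite mulSn -addnA ltnNge leq_addr /= addKn.
Qed.

Lemma gate_field (i : 'I_s) (k : nat) : (k < 3)%N ->
  nth 0%N (circuit_numbers C) (k.+2 + (i + (i + i))) =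
  nth 0%N (gate_numbers (cgate i)) k.
Proof.
move=> k3; rewrite !addSn [LHS]/=.
have -> : (k + (i + (i + i)) = i * 3 + k)%N.
  by rewrite addnC !mulnS muln0 addn0.
rewrite nth_flatten_uniform //; last first.
  by apply/allP => _ /mapP [j _ ->]; case: (cgate j).
by rewrite (nth_map i) ?size_enum_ord // nth_ord_enum.
Qed.

Lemma gate_at (y : nat) (i : 'I_s) (a b e : 'I_D) : y./2 = cell D i a b e ->
  exists y' : 'I_N, [/\ nat_of_ord y' = y,
    gate_numbers_at y = gate_numbers (row_gate i a b e y') &
    gate_label_at y = gate_label (row_gate i a b e y')].
Proof.
move=> yE; have yN : (y < N)%N.
  by rewrite -ltn_half_double yE cell_lt.
exists (Ordinal yN); rewrite /gate_numbers_at /gate_label_at insubT.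
by rewrite (@quotient_gateE _ _ _ _ (Sub y yN) i a b e).
Qed.

Section EmitGates.
Local Arguments run : simpl never.

Variables (st : state R) (i : 'I_s) (a b e : 'I_D).
Hypothesis input_st : has_input st.
Hypothesis table_st : forall y, (y <= s * D * D)%N -> nmem st 2 y = (y * D)%N.
Hypotheses (z_st : nmem st 4 0 = cell D i a b e) (e_st : nmem st 5 0 = e)
  (b_st : nmem st 6 0 = b) (a_st : nmem st 7 0 = a) (i_st : nmem st 8 0 = i).

Lemma neval_field (k : nat) : (k < 3)%N ->
  neval st (field k) = nth 0%N (gate_numbers (cgate i)) k.
Proof.
by have [in0 _ _] := input_st; move=> k3; rewrite -gate_field //= in0 i_st.
Qed.

Lemma neval_degree : neval st degree_exp = d.
Proof. by have [_ in1 _] := input_st; rewrite /= in1. Qed.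

(** The three nested lookups use the indices [j], [j * D + a'] and [(j * D + a') * D + b'], all
    within the filled range [s * D * D]. *)
Lemma neval_cell (ej ea eb ee : nexp) (j : 'I_s) (a' b' : 'I_D) :
  neval st ej = j -> neval st ea = a' -> neval st eb = b' ->
  neval st (cell_exp ej ea eb ee) = cell D j a' b' (neval st ee).
Proof.
move=> /= -> -> ->; rewrite (table_st (y := j)); last first.
  by rewrite -mulnA (leq_trans (ltnW (ltn_ord j))) // leq_pmulr.
rewrite (table_st (y := (j * D + a')%N)); last first.
  have := digit_lt (ltn_ord j) (ltn_ord a') => /ltnW jaD.
  by rewrite (leq_trans jaD) // leq_pmulr.
by rewrite table_st // ltnW // !digit_lt.
Qed.

Lemma neval_entry (ej ea eb : nexp) (j : 'I_s) (a' b' : 'I_D) :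
  neval st ej = j -> neval st ea = a' -> neval st eb = b' ->
  neval st (entry_exp ej ea eb) = entry_index m j a' b'.
Proof.
move=> jE aE bE.
have := neval_cell degree_exp jE aE bE; rewrite neval_degree /entry_exp.
by move: (cell_exp _ _ _ _) => c /= ->; rewrite addnn addn1.
Qed.

Lemma run_twice_emit e0 e1 e2 r :
  run (twice (emit e0 e1 e2 r)) st =
  append st [:: neval st e0; neval st e1; neval st e2;
                neval st e0; neval st e1; neval st e2]
    [:: reval st r; reval st r].
Proof.
rewrite -[LHS]/(run (emit e0 e1 e2 r) (run (emit e0 e1 e2 r) st)) !run_emit.
by rewrite !neval_append reval_append append_cat.
Qed.

Lemma run_If t p q :
  run (If t p q) st = if teval st t then run p st else run q st.
Proof. by []. Qed.

Lemma run_emit_gates (z := cell D i a b e) :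
  run emit_gates st =
  append st (gate_numbers_at z.*2 ++ gate_numbers_at z.*2.+1)
    [:: gate_label_at z.*2; gate_label_at z.*2.+1].
Proof.
have zE : z.*2./2 = cell D i a b e by rewrite doubleK.
have zE' : z.*2.+1./2 = cell D i a b e.
  by rewrite -[LHS]/(uphalf z.*2) uphalf_double.
have [y [yE -> ->]] := gate_at zE; have [y' [y'E -> ->]] := gate_at zE'.
have [in0 in1 in2] := input_st.
have ae : neval st a_exp = a by [].
have be : neval st b_exp = b by [].
have ee : neval st e_exp = e by [].
have f0 := neval_field (k := 0) isT; have f1 := neval_field (k := 1) isT.
have f2 := neval_field (k := 2) isT.
have -> : run emit_gates st =
    if neval st (field 0) == 0%N then run emit_const_gate st
    else if neval st (field 0) == 1%N then run emit_var_gate st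
    else if neval st (field 0) == 2 then run emit_add_gate st
    else run emit_mul_gate st by [].
rewrite /row_gate valKd f0 {f0}.
case gi: (cgate i) f1 f2 => [c|x|j k|j k] f1 f2 /=.
- rewrite /emit_const_gate run_If /teval ae be.
  case: (_ == _ :> nat); rewrite run_twice_emit //=.
  by rewrite in2 i_st (nth_map i) ?size_enum_ord // nth_ord_enum gi.
- rewrite /emit_var_gate !run_If /teval ae be neval_degree f1.
  have -> : neval st (NAdd a_exp (NLit 1)) = a.+1 by rewrite /= a_st addn1.
  have -> : neval st (NRead 1 (NAdd (NLit 2) a_exp)) =
      nth 0%N [seq nat_of_ord x | x <- m] a by rewrite /= in1 a_st.
  case: eqP => ab /=; last first.
    case: eqP => _ /=; last by rewrite run_twice_emit.
    by case: eqP => _; rewrite run_twice_emit.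
  case: eqP => _ /=.
    by rewrite run_twice_emit /= -[nmem _ _ _]/(neval st (field 1)) f1.
  (* Here [a = b] differs from [d], and [b = a.+1] is impossible, so the entry is 0. *)
  by rewrite ab ltn_eqF //= run_twice_emit.
- rewrite /emit_add_gate run_twice_emit !val_entry.
  by rewrite (neval_entry f1 ae be) (neval_entry f2 ae be).
pose p := emit (NLit 3) (entry_exp (field 1) a_exp e_exp)
  (entry_exp (field 2) e_exp b_exp) RZero.
pose q := emit (NLit 2) (double_exp z_exp)
  (NSub (double_exp z_exp) (NLit 1)) RZero.
have -> : run emit_mul_gate st =
    if (0 < neval (run p st) e_exp)%N then run q (run p st)
    else run p (run p st) by [].
(* At [e = 0] the product is emitted a second time, after the tapes have changed; output does not
   affect the values of expressions. *)
have pE st' : st' = st \/ (exists ns rs, st' = append st ns rs) ->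
    run p st' =
    append st' [:: 3%N; entry_index m j a e; entry_index m k e b] [:: 0].
  have pe1 := neval_entry f1 ae ee; have pe2 := neval_entry f2 ee be.
  by case=> [->|[ns [rs ->]]]; rewrite run_emit ?neval_append pe1 pe2.
rewrite (pE st); last by left.
rewrite neval_append ee pE; last by right; do 2!eexists.
have zz : neval st (double_exp z_exp) = z.*2 by rewrite /= z_st addnn.
rewrite run_emit !neval_append reval_append !append_cat.
have -> : neval st (NSub (double_exp z_exp) (NLit 1)) = z.*2.-1.
  by rewrite -[LHS]/(neval st (double_exp z_exp) - 1)%N zz subn1.
rewrite zz yE y'E /= odd_double /=.
case: ifP => _ /=; last by rewrite !val_entry.
by rewrite !val_entry !val_below ?y'E ?leq_pred // (leq_trans (leq_pred _)).
Qed.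


End EmitGates.

Lemma dvdn_succ (z : nat) : (D %| z.+1)%N = ((z %% D).+1 == D).
Proof.
rewrite {1}(divn_eq z D) -addnS dvdn_addr ?dvdn_mull //.
apply/idP/eqP => [/(dvdn_leq (ltn0Sn _)) le|->]; last exact: dvdnn.
by apply/eqP; rewrite eqn_leq le ltn_mod.
Qed.

Definition counters (z : nat) st : Prop :=
  [/\ nmem st 4 0 = z, nmem st 5 0 = (z %% D)%N,
      nmem st 6 0 = (z %/ D %% D)%N, nmem st 7 0 = (z %/ D %/ D %% D)%N &
      nmem st 8 0 = (z %/ D %/ D %/ D)%N].

(** At each digit, the carry test is the divisibility by [D] that governs [divnS] and [modnS],
    applied to the number formed by that digit and the higher ones. *)
Lemma run_advance (z : nat) st : has_input st -> counters z st ->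
  let st' := run advance st in
  [/\ has_input st', counters z.+1 st', nmem st' 2 = nmem st 2,
      nout st' = nout st & rout st' = rout st].
Proof.
move=> [in0 in1 in2] [c4 c5 c6 c7 c8].
rewrite /counters /has_input /= /update /= in1 /= !addn1 c5.
rewrite (divnS z) // (modnS z) dvdn_succ.
case: (_ == _ :> nat) => /=; last by rewrite add0n ?c4 ?c5.
rewrite add1n c6 (divnS (z %/ D)) // (modnS (z %/ D)) dvdn_succ.
case: (_ == _ :> nat) => /=; last by rewrite add0n ?c4 ?c6.
rewrite add1n c7 (divnS (z %/ D %/ D)) // (modnS (z %/ D %/ D)) dvdn_succ.
case: (_ == _ :> nat) => /=; last by rewrite add0n ?c4 ?c7.
by rewrite add1n ?c4 ?c8.
Qed.

Definition table_upto (x : nat) st : Prop :=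
  forall y, (y <= x)%N -> nmem st 2 y = (y * D)%N.

Definition fill_invariant (x : nat) st : Prop :=
  [/\ has_input st, nmem st 3 0 = x, table_upto x st, counters 0 st &
      nout st = [::] /\ rout st = [::]].

Definition fill_length : nat := (s + (s * D + s * D * D))%N.

Lemma fill_guardE (x : nat) st : fill_invariant x st -> (x <= fill_length)%N ->
  teval st fill_guard = (x < fill_length)%N.
Proof.
move=> [[in0 _ _] x_st table_st _ _] xle.
have s_st : nmem st 0 0 = s by rewrite in0.
(* While [x < s], the first summand alone makes the guard true, whatever the unfilled entries hold.
   From [x = s] on the second summand is final, and it suffices up to [s + s * D]; by then entry
   [s * D] is filled too. *)
rewrite /= !x_st !s_st /fill_length; have [xs|sx] := ltnP x s.
  by rewrite !(ltn_addr _ xs).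
rewrite (table_st s sx).
have [xs|sDx] := ltnP x (s + s * D)%N; first by rewrite !addnA !(ltn_addr _ xs).
by rewrite (table_st (s * D)%N) // (leq_trans _ sDx) // leq_addl.
Qed.

Lemma run_fill_body (x : nat) st :
  fill_invariant x st -> fill_invariant x.+1 (run fill_body st).
Proof.
move=> [[in0 in1 in2] x_st table_st c_st out_st].
split=> //=; rewrite /update /= ?x_st ?addn1 // => y.
rewrite leq_eqVlt => /predU1P [->|] /=.
  by rewrite eqxx (table_st x) // in1 /= mulSn addnC.
by rewrite ltnS => yx; rewrite ltn_eqF ?ltnS // table_st.
Qed.

Definition main_invariant (z : nat) st : Prop :=
  [/\ has_input st, counters z st, table_upto (s * D * D) st,
      nout st = numbers_upto z.*2 & rout st = labels_upto z.*2].

Lemma neval_cells_exp st : has_input st -> table_upto (s * D * D) st ->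
  neval st cells_exp = cells C m.
Proof.
move=> [in0 _ _] table_st; rewrite /= in0 /= (table_st s); last first.
  by rewrite -mulnA leq_pmulr.
by rewrite (table_st (s * D)%N) ?table_st // leq_pmulr.
Qed.

Lemma run_emit_header st : fill_invariant fill_length st ->
  main_invariant 0 (run emit_header st).
Proof.
move=> [input_st _ table_st counters_st [nout_st rout_st]].
have {}table_st : table_upto (s * D * D) st.
  move=> y yle; apply: table_st.
  by rewrite (leq_trans yle) // /fill_length addnA leq_addl.
have cells_st := neval_cells_exp input_st table_st.
have out_st : neval st (entry_exp (NRead 0 (NLit 1)) (NLit 0) degree_exp) =
    entry_index m (cout C) 0 d.
  apply: (@neval_entry st input_st table_st _ _ _ _ ord0 ord_max) => //.
    by have [in0 _ _] := input_st; rewrite /= in0.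
  exact: neval_degree.
split=> //.
  rewrite /emit_header -[nout _]/(rcons (rcons (nout st) _) _) neval_output.
  by rewrite nout_st out_st /numbers_upto -addnn -cells_st.
Qed.

Lemma run_main_body (z : nat) st : main_invariant z st -> (z < cells C m)%N ->
  main_invariant z.+1 (run main_body st).
Proof.
move=> [input_st counters_st table_st nout_st rout_st] zlt.
have [i [a [b [e zE]]]] := cellP zlt.
have [z_st e_st b_st a_st i_st] := counters_st.
have [eE bE aE iE] := cell_coords i (ltn_ord a) (ltn_ord b) (ltn_ord e).
rewrite zE in z_st e_st b_st a_st i_st.
rewrite eE in e_st; rewrite bE in b_st; rewrite aE in a_st; rewrite iE in i_st.
have := run_emit_gates input_st table_st z_st e_st b_st a_st i_st.
rewrite -zE -[run main_body st]/(run advance (run emit_gates st)) => ->.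
set st1 := append _ _ _.
have [] := @run_advance z st1 input_st counters_st.
move: (run advance st1) => st2 input2 counters2 table2 nout2 rout2.
split=> //; first by move=> y yle; rewrite table2; apply: table_st.
  (* One cell extends the output by its two gates, [z.*2] and [z.*2.+1]. *)
  rewrite nout2 /= nout_st /numbers_upto doubleS -addn2 iotaD map_cat.
  by rewrite flatten_cat /= cats0.
by rewrite rout2 /= rout_st /labels_upto doubleS -addn2 iotaD map_cat.
Qed.

Lemma quotient_program_correct : exists t,
  maps_circuit quotient_program C m t (quotient_circuit C m) /\
      (t <= fill_length * (cost fill_body).+1 + 1
             + (cost emit_header + (cells C m * (cost main_body).+1 + 1)))%N.
Proof.
pose st0 : state R :=
  init [:: circuit_numbers C; monom_numbers m] [:: circuit_labels C].
have fill0 : fill_invariant 0 st0.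
  (* Arrays outside the input start as zeros, so entry 0 of the table and all the counters are
     already correct. *)
  by split=> // y; rewrite leqn0 => /eqP ->; rewrite ?mul0n.
have [||//|t1 [st1 [h1 I1 c1]]] :=
    @exec_while _ fill_guard fill_body fill_invariant fill_length st0 isT.
- by move=> k st Ik; apply: fill_guardE.
- by move=> k st Ik _; apply: run_fill_body.
have [t2 h2 c2] := @exec_run _ emit_header st1 isT.
have [||//|t3 [st3 [h3 I3 c3]]] :=
    @exec_while _ main_guard main_body main_invariant (cells C m)
      (run emit_header st1) isT.
- move=> k st [input_st [k_st _ _ _ _] table_st _ _] _.
  by rewrite /main_guard /teval neval_cells_exp // /= k_st.
- by move=> k st; apply: run_main_body.
- exact: run_emit_header.
exists (t1 + (t2 + t3))%N; split; last by rewrite leq_add ?leq_add.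
exists st3; have [_ _ _ -> ->] := I3.
rewrite numbers_upto_all labels_upto_all; split=> //.
exact: ExecSeq h1 (ExecSeq h2 h3).
Qed.

End Correctness.

Theorem theorem11 (K : fieldType) (R : algType K) :
  exists (P : program) (c k : nat),
    forall (n : nat) (C : circuit R n) (f : {malg R[{fmonom 'I_n}]})
           (m : {fmonom 'I_n}),
      computes C f ->
      exists (t : nat) (C' : circuit R n),
        [/\ maps_circuit P C m t C',
            computes C' (pcoeff f m) &
            t <= c * (csize C + n + fdeg m) ^ k].
Proof.
(* The number [s * D ^ 3] of cells gives the exponent 4. The filling loop costs at most 9 steps per
   cell and the main loop 25; the additive constant 4 is absorbed since there is at least one cell,
   so 38 would do. *)
exists quotient_program, 40%N, 4%N => n C f m Cf.
have [t [ht ct]] := quotient_program_correct C m.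
exists t, (quotient_circuit C m).
split=> //; first exact: quotient_circuit_computes.
(* The output gate witnesses that [C] is nonempty; this also provides the 1 needed for [D <= X]. *)
have X_gt0 : (0 < csize C)%N by apply: leq_ltn_trans (ltn_ord (cout C)).
rewrite fdegE; set X := (csize C + n + size m)%N.
have sX : (csize C <= X)%N by rewrite /X -addnA leq_addr.
have DX : ((size m).+1 <= X)%N by rewrite /X -addn1 addnC leq_add2r ltn_addr.
have cells_le : (cells C m <= X ^ 4)%N.
  by rewrite /cells !expnS expn0 muln1 !mulnA !leq_mul.
have [s1 s2 s3] : [/\ csize C <= csize C * (size m).+1,
    csize C * (size m).+1 <= csize C * (size m).+1 * (size m).+1 &
    csize C * (size m).+1 * (size m).+1 <= cells C m]%N.
  by rewrite /cells !leq_pmulr.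
move: ct; rewrite /fill_length -[cost fill_body]/2 -[cost main_body]/24.
rewrite -[cost emit_header]/2; move: cells_le s1 s2 s3 X_gt0; clear.
move: (X ^ 4) (cells C m) (csize C * (size m).+1 * (size m).+1).
by move: (csize C * (size m).+1) (csize C); lia.
Qed.
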